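(* Let $k$ be a field with algebraic closure $P$. Let $L$ be a Lie algebra over $k$ with a basis $\{e_1,e_2,e_3\}$ such that $[e_1,e_2]=0$, $[e_1,e_3]=\alpha e_1+\beta e_2$, $[e_2,e_3]=\gamma e_1+\delta e_2$, where $\alpha,\beta,\gamma,\delta\in k$ and $\alpha\delta-\beta\gamma\neq0$. Set $A=\begin{pmatrix}\alpha&\gamma\\ \beta&\delta\end{pmatrix}$. Let $p,u,s\in k$, and let $r\in\operatorname{Im}(1-\tau)$ be $$r=p(e_1\otimes e_2)-p(e_2\otimes e_1)+s(e_1\otimes e_3)-s(e_3\otimes e_1)+u(e_2\otimes e_3)-u(e_3\otimes e_2).$$ Then: (I) $(L,[\ ],\Delta_r,r)$ is a coboundary Lie bialgebra if and only if $$(s,u)\begin{pmatrix}\beta\delta+\alpha\beta&-\beta\gamma-\alpha^2\\ \delta^2+\gamma\beta&-\delta\gamma-\gamma\alpha\end{pmatrix}\begin{pmatrix} s \\ u \end{pmatrix}=0.$$ (II) If $\operatorname{char}k=2$, the two characteristic roots of $A$ are equal, and $A$ is similar to a diagonal matrix over $P$, then $(L,[\ ],\Delta_r,r)$ is a triangular Lie bialgebra for any $r\in\operatorname{Im}(1-\tau)$. (III) If the condition in (II) does not hold (that is, it is not the case that $\operatorname{char}k=2$, the two characteristic roots of $A$ are equal and $A$ is similar to a diagonal matrix over $P$), then $(L,[\ ],\Delta_r,r)$ is a triangular Lie bialgebra if and only if $-\beta s^2+\gamma u^2+(\alpha-\delta)us=0$.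
   Context: $\tau:L\otimes L\to L\otimes L$ is the flip $\tau(a\otimes b)=b\otimes a$, and $\operatorname{Im}(1-\tau)$ is the image of $\mathrm{id}-\tau$ on $L\otimes L$. Let $\xi:L^{\otimes3}\to L^{\otimes3}$ be the cyclic permutation $\xi(a\otimes b\otimes c)=b\otimes c\otimes a$. $L$ acts on $L\otimes L$ by $x\cdot(a\otimes b)=[x,a]\otimes b+a\otimes[x,b]$. For $r\in L\otimes L$, $\Delta_r:L\to L\otimes L$ is the linear map $\Delta_r(x)=x\cdot r$. A Lie bialgebra is a triple $(L,[\ ],\Delta)$ where $(L,[\ ])$ is a Lie algebra, $\Delta:L\to L\otimes L$ is a linear map making $L$ a Lie coalgebra, i.e. $\operatorname{Im}\Delta\subseteq\operatorname{Im}(1-\tau)$ and $(1+\xi+\xi^2)(1\otimes\Delta)\Delta=0$, and $\Delta([x,y])=x\cdot\Delta(y)-y\cdot\Delta(x)$ for all $x,y\in L$. $(L,[\ ],\Delta_r,r)$ is a coboundary Lie bialgebra if $r\in\operatorname{Im}(1-\tau)$ and $(L,[\ ],\Delta_r)$ is a Lie bialgebra. It is a triangular Lie bialgebra if it is a coboundary Lie bialgebra and moreover $r$ is a solution of the classical Yang-Baxter equation $[r^{12},r^{13}]+[r^{12},r^{23}]+[r^{13},r^{23}]=0$ in $L\otimes L\otimes L$, where for $r=\sum_i a_i\otimes b_i$ one puts $[r^{12},r^{13}]=\sum_{i,j}[a_i,a_j]\otimes b_i\otimes b_j$, $[r^{12},r^{23}]=\sum_{i,j}a_i\otimes[b_i,a_j]\otimes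 b_j$, $[r^{13},r^{23}]=\sum_{i,j}a_i\otimes a_j\otimes[b_i,b_j]$. *)

(* Defs.v *)
From HB Require Import structures.
From mathcomp Require Import all_boot all_order all_algebra.
Set Implicit Arguments.
Unset Strict Implicit.
Unset Printing Implicit Defensive.
Import GRing.Theory.
Local Open Scope ring_scope.

(* Tensor product of finite-dimensional spaces: the element of U (x) V with
   coordinates t i j in the basis u_i (x) v_j, where (u_i) and (v_j) are the
   library's bases vbasis of U and V, is encoded by the matrix t. The lemmas
   tens_is_bilinear, tlift_tens and tlift_unique below give its universal
   property. *)
Definition tensor (k : fieldType) (U V : vectType k) : Type :=
  'M[k]_(\dim {:U}, \dim {:V}).

HB.instance Definition _ (k : fieldType) (U V : vectType k) :=
  Vector.on (tensor U V).

Definition tens (k : fieldType) (U V : vectType k) (a : U) (b : V) :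
    tensor U V :=
  \matrix_(i, j) (coord (vbasis {:U}) i a * coord (vbasis {:V}) j b).

Notation "a ⊗ b" := (tens a b) (at level 40, left associativity) : ring_scope.

(* For bilinear f, the linear map U (x) V -> W sending a (x) b to f a b. For
   arbitrary f it is only linear, hence f is required to be bilinear in a and b
   wherever tlift is used. *)
Definition tlift (k : fieldType) (U V : vectType k) (W : lmodType k)
    (f : U -> V -> W) (t : tensor U V) : W :=
  \sum_i \sum_j t i j *: f (vbasis {:U})`_i (vbasis {:V})`_j.

Lemma tlift_is_linear (k : fieldType) (U V : vectType k) (W : lmodType k)
  (f : U -> V -> W) : linear (tlift f).
Proof.
move=> c s t; rewrite /tlift scaler_sumr -big_split; apply: eq_bigr => i _.
rewrite scaler_sumr -big_split; apply: eq_bigr => j _.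
by rewrite !mxE scalerDl scalerA.
Qed.

HB.instance Definition _ (k : fieldType) (U V : vectType k) (W : lmodType k)
    (f : U -> V -> W) :=
  GRing.isLinear.Build k (tensor U V) W *:%R (tlift f) (tlift_is_linear f).

Lemma tens_is_bilinear (k : fieldType) (U V : vectType k) :
  bilinear_for *:%R *:%R (@tens k U V).
Proof.
split=> [b|a] c x y; apply/matrixP=> i j; rewrite !mxE linearP /=.
  by rewrite mulrDl mulrA.
by rewrite mulrDr mulrCA.
Qed.

HB.instance Definition _ (k : fieldType) (U V : vectType k) :=
  bilinear_isBilinear.Build k U V (tensor U V) *:%R *:%R (@tens k U V)
    (tens_is_bilinear U V).

Lemma tlift_tens (k : fieldType) (U V : vectType k) (W : lmodType k)
    (f : U -> V -> W) (a : U) (b : V) :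
  bilinear_for *:%R *:%R f -> tlift f (a ⊗ b) = f a b.
Proof.
move=> [fl fr].
pose fB := bilinear_isBilinear.Build k U V W *:%R *:%R f (fl, fr).
pose g : {bilinear U -> V -> W} := HB.pack f fB.
have fE : f = g by [].
rewrite {2}(coord_vbasis (memvf a)) {2}(coord_vbasis (memvf b)) fE.
rewrite /tlift linear_sumlz; apply: eq_bigr => i _.
rewrite linear_sumr; apply: eq_bigr => j _.
by rewrite mxE linearZl_LR linearZr_LR scalerA.
Qed.

Lemma tensor_expand (k : fieldType) (U V : vectType k) (t : tensor U V) :
  t = \sum_i \sum_j t i j *: ((vbasis {:U})`_i ⊗ (vbasis {:V})`_j).
Proof.
have fU := basis_free (vbasisP {:U}); have fV := basis_free (vbasisP {:V}).
apply/matrixP=> i j; rewrite summxE (bigD1 i) //= summxE (bigD1 j) //=.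
rewrite !mxE !coord_free // !eqxx !mulr1 big1 => [|j' nj]; last first.
  by rewrite !mxE !coord_free // (negPf nj) mulr0 mulr0.
rewrite addr0 big1 ?addr0 // => i' ni; rewrite summxE big1 // => j' _.
by rewrite !mxE !coord_free // (negPf ni) mul0r mulr0.
Qed.

Lemma tlift_unique (k : fieldType) (U V : vectType k) (W : lmodType k)
    (f : U -> V -> W) (g : {linear tensor U V -> W}) :
  (forall a b, g (a ⊗ b) = f a b) -> g =1 tlift f.
Proof.
move=> gE t; rewrite {1}(tensor_expand t) linear_sum; apply: eq_bigr => i _.
by rewrite linear_sum; apply: eq_bigr => j _; rewrite linearZ gE.
Qed.

Definition flip (k : fieldType) (L : vectType k) : tensor L L -> tensor L L :=
  tlift (fun a b => b ⊗ a).

Definition in_Im_1_sub_flip (k : fieldType) (L : vectType k)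
    (t : tensor L L) : Prop :=
  exists s : tensor L L, t = s - flip s.

(* L (x) L (x) L is taken as L (x) (L (x) L). *)
Definition cycle3 (k : fieldType) (L : vectType k) :
    tensor L (tensor L L) -> tensor L (tensor L L) :=
  tlift (fun a => tlift (fun b c => b ⊗ (c ⊗ a))).

Definition id_tens (k : fieldType) (L : vectType k)
    (D : {linear L -> tensor L L}) : tensor L L -> tensor L (tensor L L) :=
  tlift (fun a b => a ⊗ D b).

Definition is_lie_bracket (k : fieldType) (L : vectType k)
    (br : {bilinear L -> L -> L}) : Prop :=
  (forall x, br x x = 0) /\
  (forall x y z, br x (br y z) + br y (br z x) + br z (br x y) = 0).

Definition act (k : fieldType) (L : vectType k) (br : {bilinear L -> L -> L})
    (x : L) : tensor L L -> tensor L L :=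
  tlift (fun a b => br x a ⊗ b + a ⊗ br x b).

Definition is_lie_coalgebra (k : fieldType) (L : vectType k)
    (D : {linear L -> tensor L L}) : Prop :=
  (forall x, in_Im_1_sub_flip (D x)) /\
  (forall x, let t := id_tens D (D x) in
    t + cycle3 t + cycle3 (cycle3 t) = 0).

Definition is_lie_bialgebra (k : fieldType) (L : vectType k)
    (br : {bilinear L -> L -> L}) (D : {linear L -> tensor L L}) : Prop :=
  [/\ is_lie_bracket br,
      is_lie_coalgebra D
    & forall x y, D (br x y) = act br x (D y) - act br y (D x)].

Definition Delta (k : fieldType) (L : vectType k) (br : {bilinear L -> L -> L})
    (r : tensor L L) (x : L) : tensor L L := act br x r.

Lemma Delta_is_linear (k : fieldType) (L : vectType k)
    (br : {bilinear L -> L -> L}) (r : tensor L L) : linear (Delta br r).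
Proof.
move=> c x y; rewrite /Delta /act /tlift scaler_sumr -big_split.
apply: eq_bigr => i _; rewrite scaler_sumr -big_split; apply: eq_bigr => j _.
rewrite !linearPl linearPr /= scalerA mulrC -scalerA -scalerDr.
by congr (_ *: _); rewrite scalerDr addrACA.
Qed.

HB.instance Definition _ (k : fieldType) (L : vectType k)
    (br : {bilinear L -> L -> L}) (r : tensor L L) :=
  GRing.isLinear.Build k L (tensor L L) *:%R (Delta br r)
    (Delta_is_linear br r).

Definition is_coboundary (k : fieldType) (L : vectType k)
    (br : {bilinear L -> L -> L}) (r : tensor L L) : Prop :=
  in_Im_1_sub_flip r /\ is_lie_bialgebra br (Delta br r).

(* [r12, r13], [r12, r23] and [r13, r23]. Writing r = \sum_i a_i (x) b_i, the
   outer tlift runs over a_i (x) b_i and the inner one over a_j (x) b_j; see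
   the lemmas bracket12_13E, bracket12_23E and bracket13_23E. *)
Definition bracket12_13 (k : fieldType) (L : vectType k)
    (br : {bilinear L -> L -> L}) (r : tensor L L) : tensor L (tensor L L) :=
  tlift (fun a b => tlift (fun c d => br a c ⊗ (b ⊗ d)) r) r.

Definition bracket12_23 (k : fieldType) (L : vectType k)
    (br : {bilinear L -> L -> L}) (r : tensor L L) : tensor L (tensor L L) :=
  tlift (fun a b => tlift (fun c d => a ⊗ (br b c ⊗ d)) r) r.

Definition bracket13_23 (k : fieldType) (L : vectType k)
    (br : {bilinear L -> L -> L}) (r : tensor L L) : tensor L (tensor L L) :=
  tlift (fun a b => tlift (fun c d => a ⊗ (c ⊗ br b d)) r) r.

Definition is_cybe_solution (k : fieldType) (L : vectType k)
    (br : {bilinear L -> L -> L}) (r : tensor L L) : Prop :=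
  bracket12_13 br r + bracket12_23 br r + bracket13_23 br r = 0.

Definition is_triangular (k : fieldType) (L : vectType k)
    (br : {bilinear L -> L -> L}) (r : tensor L L) : Prop :=
  is_coboundary br r /\ is_cybe_solution br r.

Lemma flip_tens (k : fieldType) (L : vectType k) (a b : L) :
  flip (a ⊗ b) = b ⊗ a.
Proof.
by rewrite /flip tlift_tens //; split=> z c x y /=; rewrite ?linearPl ?linearPr.
Qed.

Lemma tlift_ext (k : fieldType) (U V : vectType k) (W : lmodType k)
  (f g : U -> V -> W) : f =2 g -> tlift f =1 tlift g.
Proof.
by move=> fg t; apply: eq_bigr => i _; apply: eq_bigr => j _; rewrite fg.
Qed.

Lemma tlift_funP (k : fieldType) (U V : vectType k) (W : lmodType k)
  (f g h : U -> V -> W) (c : k) (t : tensor U V) :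
  (forall a b, f a b = c *: g a b + h a b) ->
  tlift f t = c *: tlift g t + tlift h t.
Proof.
move=> E; rewrite /tlift scaler_sumr -big_split; apply: eq_bigr => i _.
rewrite scaler_sumr -big_split; apply: eq_bigr => j _.
by rewrite E scalerDr !scalerA mulrC.
Qed.

Lemma cycle3_tens (k : fieldType) (L : vectType k) (a b c : L) :
  cycle3 (a ⊗ (b ⊗ c)) = b ⊗ (c ⊗ a).
Proof.
rewrite /cycle3 tlift_tens /=.
  by rewrite tlift_tens //; split=> z e x y /=; rewrite ?(linearPl, linearPr).
split=> [t|x] e y z /=; last by rewrite linearP.
by apply: tlift_funP => x w; rewrite !linearPr.
Qed.

Lemma id_tens_tens (k : fieldType) (L : vectType k)
    (D : {linear L -> tensor L L}) (a b : L) :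
  id_tens D (a ⊗ b) = a ⊗ D b.
Proof.
rewrite /id_tens tlift_tens //.
by split=> z c x y /=; rewrite ?linearPl ?linearP ?linearPr.
Qed.

Lemma act_tens (k : fieldType) (L : vectType k) (br : {bilinear L -> L -> L})
    (x a b : L) :
  act br x (a ⊗ b) = br x a ⊗ b + a ⊗ br x b.
Proof.
rewrite /act tlift_tens //; split=> z c y w /=;
by rewrite !(linearPl, linearPr) scalerDr addrACA.
Qed.

Lemma tlift2_sum (k : fieldType) (L : vectType k) (W : lmodType k)
    (f : L -> L -> L -> L -> W) (I : Type) (s : seq I) (a b : I -> L)
    (r : tensor L L) :
  (forall x y, bilinear_for *:%R *:%R (f x y)) ->
  (forall x y, bilinear_for *:%R *:%R (fun z w => f z w x y)) ->
  r = \sum_(i <- s) a i ⊗ b i ->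
  tlift (fun x y => tlift (f x y) r) r =
  \sum_(i <- s) \sum_(j <- s) f (a i) (b i) (a j) (b j).
Proof.
move=> f2 f1 rE.
pose F x y : W := tlift (f x y) r.
rewrite -[LHS]/(tlift F r) [X in tlift F X]rE linear_sum.
apply: eq_bigr => i _; rewrite [LHS]tlift_tens /F.
  by rewrite rE linear_sum; apply: eq_bigr => j _; apply: tlift_tens.
split=> z c x y; apply: tlift_funP => v w.
  by have [h _] := f1 v w; apply: h.
by have [_ h] := f1 v w; apply: h.
Qed.

Lemma bracket12_13E (k : fieldType) (L : vectType k)
    (br : {bilinear L -> L -> L}) (I : Type) (s : seq I) (a b : I -> L)
    (r : tensor L L) :
  r = \sum_(i <- s) a i ⊗ b i ->
  bracket12_13 br r =
  \sum_(i <- s) \sum_(j <- s) br (a i) (a j) ⊗ (b i ⊗ b j).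
Proof.
by apply: (tlift2_sum (f := fun x y z w => br x z ⊗ (y ⊗ w))) => x y;
  split=> z c v w /=; rewrite !(linearPl, linearPr).
Qed.

Lemma bracket12_23E (k : fieldType) (L : vectType k)
    (br : {bilinear L -> L -> L}) (I : Type) (s : seq I) (a b : I -> L)
    (r : tensor L L) :
  r = \sum_(i <- s) a i ⊗ b i ->
  bracket12_23 br r =
  \sum_(i <- s) \sum_(j <- s) a i ⊗ (br (b i) (a j) ⊗ b j).
Proof.
by apply: (tlift2_sum (f := fun x y z w => x ⊗ (br y z ⊗ w))) => x y;
  split=> z c v w /=; rewrite !(linearPl, linearPr).
Qed.

Lemma bracket13_23E (k : fieldType) (L : vectType k)
    (br : {bilinear L -> L -> L}) (I : Type) (s : seq I) (a b : I -> L)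
    (r : tensor L L) :
  r = \sum_(i <- s) a i ⊗ b i ->
  bracket13_23 br r =
  \sum_(i <- s) \sum_(j <- s) a i ⊗ (a j ⊗ br (b i) (b j)).
Proof.
by apply: (tlift2_sum (f := fun x y z w => x ⊗ (z ⊗ br y w))) => x y;
  split=> z c v w /=; rewrite !(linearPl, linearPr).
Qed.

Definition mx2 (R : Type) (a b c d : R) : 'M[R]_2 :=
  \matrix_(i, j) if i == 0 then (if j == 0 then a else b)
                 else (if j == 0 then c else d).

Definition row2 (R : Type) (a b : R) : 'rV[R]_2 :=
  \row_j if j == 0 then a else b.

Definition is_algebraic_closure (k : fieldType) (P : closedFieldType)
    (iota : {rmorphism k -> P}) : Prop :=
  forall x : P, algebraicOver iota x.

(* char k = 2, and over P the two characteristic roots of A coincide and A is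
   similar to a diagonal matrix. *)
Definition char2_equal_roots_diag (k : fieldType) (P : closedFieldType)
    (iota : {rmorphism k -> P}) (A : 'M[k]_2) : Prop :=
  [/\ 2 \in [pchar k],
      exists x y : P,
        char_poly (map_mx iota A) = ('X - x%:P) * ('X - y%:P) /\ x = y
    & diagonalizable (map_mx iota A)].

(* Main.v *)
(* Write T for the map e1 |-> [e1,e3], e2 |-> [e2,e3] on <e1,e2> and
   w = s e1 + u e2, so that r = p e1 /\ e2 + w /\ e3. The Yang-Baxter
   expression of r is -(w /\ T w) /\ e3, that is disc s u times e1 /\ e2 /\ e3,
   where disc s u is the form appearing in (III). The co-Jacobi expression at x
   is, up to sign, the action of x on it, and e3 acts on e1 /\ e2 /\ e3 by minus
   the trace alpha + delta; hence (I). In case (II) A is scalar and disc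
   vanishes. Identities between tensors are reduced to polynomial identities by
   evaluating them on f (x) g (x) h for arbitrary linear forms f, g, h, with no
   restriction on the characteristic. *)
Require Import Defs.
From mathcomp Require Import all_boot all_order all_algebra.
From mathcomp Require Import ring.
Set Implicit Arguments.
Unset Strict Implicit.
Unset Printing Implicit Defensive.
Import GRing.Theory.
Local Open Scope ring_scope.

(** * Evaluating tensors on products of linear forms *)

Section Pairing.
Variable k : fieldType.

(** The forms are bare functions, with linearity as a separate hypothesis [scalar], so that
    composites such as [f \o br x] or [tpair g h] serve as forms directly. *)
Definition tpair (U V : vectType k) (f : U -> k) (g : V -> k)
    (t : tensor U V) : k :=
  tlift (W := k^o) (fun a b => f a * g b) t.

Lemma tpair_scalar (U V : vectType k) (f : U -> k) (g : V -> k) :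
  scalar (tpair f g).
Proof. by move=> c t t'; rewrite /tpair tlift_is_linear. Qed.

Lemma tpair_tens (U V : vectType k) (f : U -> k) (g : V -> k) a b :
  scalar f -> scalar g -> tpair f g (a ⊗ b) = f a * g b.
Proof.
move=> fP gP; rewrite /tpair tlift_tens //; split=> z c x y /=.
  by rewrite fP mulrDl -mulrA.
by rewrite gP mulrDr mulrCA.
Qed.

Lemma scalar_morph (U : lmodType k) (f : U -> k) : scalar f ->
  [/\ f 0 = 0, {morph f : x y / x + y}, {morph f : x / - x}
    & forall c, {morph f : x / c *: x >-> c * x}].
Proof.
move=> fP; have fD x y : f (x + y) = f x + f y.
  by rewrite -[x]scale1r fP mul1r scale1r.
have f0 : f 0 = 0 by apply: (addrI (f 0)); rewrite -fD !addr0.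
have fZ c x : f (c *: x) = c * f x by rewrite -[c *: x]addr0 fP f0 addr0.
by split=> // x; rewrite -scaleN1r fZ mulN1r.
Qed.

Lemma scalar_sum (U : lmodType k) (f : U -> k) I (s : seq I) (F : I -> U) :
  scalar f -> f (\sum_(i <- s) F i) = \sum_(i <- s) f (F i).
Proof. by case/scalar_morph=> f0 fD _ _; apply: (big_morph f fD f0). Qed.

Lemma tpair_sum (U V : vectType k) (f : U -> k) (g : V -> k) I (s : seq I)
    (a : I -> U) (b : I -> V) : scalar f -> scalar g ->
  tpair f g (\sum_(i <- s) a i ⊗ b i) = \sum_(i <- s) f (a i) * g (b i).
Proof.
move=> fP gP; rewrite scalar_sum; last exact: tpair_scalar.
by apply: eq_bigr => i _; apply: tpair_tens.
Qed.

Lemma scalar_tlift (U V W : vectType k) (F : U -> V -> W) (G : W -> k) t :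
  scalar G -> G (tlift F t) = tlift (W := k^o) (fun a b => G (F a b)) t.
Proof.
move=> GP; have [_ _ _ GZ] := scalar_morph GP.
rewrite /tlift scalar_sum //; apply: eq_bigr => i _.
by rewrite scalar_sum //; apply: eq_bigr => j _; rewrite GZ.
Qed.

(** Contracting the first factor with a coordinate form leaves a row of [t], read as a vector of
    [V]. Separation of tensors is thereby reduced to separation in the second factor. *)
Lemma tpair_coord (U V : vectType k) (t : tensor U V) (G : V -> k) i :
  scalar G ->
  tpair (coord (vbasis {:U}) i) G t = G (\sum_j t i j *: (vbasis {:V})`_j).
Proof.
move=> GP; have [_ _ _ GZ] := scalar_morph GP.
have fU := basis_free (vbasisP {:U}).
rewrite scalar_sum // /tpair /tlift (bigD1 i) //= [X in _ + X]big1 ?addr0.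
  by apply: eq_bigr => j _; rewrite coord_free // eqxx mul1r GZ.
move=> i' ni; apply: big1 => j _.
by rewrite coord_free // (negPf ni) mul0r scaler0.
Qed.

Lemma tensor_row_eq0 (U V : vectType k) (t : tensor U V) i :
  \sum_j t i j *: (vbasis {:V})`_j = 0 -> forall j, t i j = 0.
Proof. by have /freeP fV := basis_free (vbasisP {:V}); apply: fV. Qed.

Lemma tpair_inj (U V : vectType k) (t t' : tensor U V) :
  (forall f g, scalar f -> scalar g -> tpair f g t = tpair f g t') -> t = t'.
Proof.
move=> E; apply/eqP; rewrite -subr_eq0; apply/eqP/matrixP => i j.
rewrite [RHS]mxE.
(* The coordinates of row [i] of [t - t'] are its values on pairs of coordinate forms, which vanish
   by [E]. *)
apply: tensor_row_eq0; rewrite (coord_vbasis (memvf (\sum_j _))) big1 // => m _.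
rewrite -tpair_coord; last exact: linearP.
have [_ tD tN _] := scalar_morph (@tpair_scalar U V (coord (vbasis {:U}) i)
  (coord (vbasis {:V}) m)).
by rewrite tD tN E ?subrr ?scale0r //; apply: linearP.
Qed.

Definition tpair3 (L : vectType k) (f g h : L -> k) :
    tensor L (tensor L L) -> k :=
  tpair f (tpair g h).

Lemma tpair3_inj (L : vectType k) (t t' : tensor L (tensor L L)) :
  (forall f g h, scalar f -> scalar g -> scalar h ->
     tpair3 f g h t = tpair3 f g h t') -> t = t'.
Proof.
move=> E; apply/eqP; rewrite -subr_eq0; apply/eqP/matrixP => i j.
rewrite [RHS]mxE.
(* A row is now itself a tensor in two factors, so the two-factor case applies to it. *)
apply: tensor_row_eq0; apply: tpair_inj => g h gP hP.
rewrite -tpair_coord; last exact: tpair_scalar.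
have [_ tD tN _] := scalar_morph (@tpair_scalar L (tensor L L)
  (coord (vbasis {:L}) i) (tpair g h)).
have [-> _ _ _] := scalar_morph (@tpair_scalar L L g h).
rewrite tD tN; apply/eqP; rewrite subr_eq0; apply/eqP; apply: E => //.
exact: linearP.
Qed.

Lemma tpair_flip (L : vectType k) (f g : L -> k) (t : tensor L L) :
  scalar f -> scalar g -> tpair f g (flip t) = tpair g f t.
Proof.
move=> fP gP; rewrite scalar_tlift; last exact: tpair_scalar.
by apply: (tlift_ext (W := k^o)) => a b; rewrite tpair_tens // mulrC.
Qed.

(** On [b ⊗ (c ⊗ a)] the form [h] meets [a], [f] meets [b] and [g] meets [c]; the forms thus rotate
    with the last one moving to the front. *)
Lemma tpair3_cycle (L : vectType k) (f g h : L -> k) t :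
  scalar f -> scalar g -> scalar h ->
  tpair3 f g h (cycle3 t) = tpair3 h f g t.
Proof.
move=> fP gP hP; rewrite [LHS]scalar_tlift; last exact: tpair_scalar.
apply: (tlift_ext (W := k^o)) => a t'.
rewrite scalar_tlift; last exact: tpair_scalar.
have E b c : tpair3 f g h (b ⊗ (c ⊗ a)) = h a * (f b * g c).
  rewrite /tpair3 !tpair_tens //; [ring | exact: tpair_scalar].
rewrite /tpair /tlift mulr_sumr; apply: eq_bigr => i _.
by rewrite mulr_sumr; apply: eq_bigr => j _; rewrite E; apply: mulrCA.
Qed.

End Pairing.

(** * Reduction of the coboundary condition to the co-Jacobi identity *)

Section Coboundary.
Variables (k : fieldType) (L : vectType k) (br : {bilinear L -> L -> L}).

Lemma scalar_br (f : L -> k) x : scalar f -> scalar (f \o br x).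
Proof. by move=> fP c y z; rewrite /= linearPr fP. Qed.

Lemma scalar_inj (x y : L) :
  (forall f : L -> k, scalar f -> f x = f y) -> x = y.
Proof.
move=> E; rewrite (coord_vbasis (memvf x)) (coord_vbasis (memvf y)).
by apply: eq_bigr => i _; rewrite E //; apply: linearP.
Qed.

Lemma tpair_act (f g : L -> k) x t : scalar f -> scalar g ->
  tpair f g (act br x t) = tpair (f \o br x) g t + tpair f (g \o br x) t.
Proof.
move=> fP gP; rewrite scalar_tlift; last exact: tpair_scalar.
have [_ tD _ _] := scalar_morph (tpair_scalar f g).
have E a b : tpair f g (br x a ⊗ b + a ⊗ br x b)
    = f (br x a) * g b + f a * g (br x b) by rewrite tD !tpair_tens.
rewrite /tpair /tlift -big_split; apply: eq_bigr => i _.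
rewrite -big_split; apply: eq_bigr => j _.
by rewrite [X in _ *: X]E; apply: mulrDr.
Qed.

Lemma tpair3_id_tens (D : {linear L -> tensor L L}) (f g h : L -> k) t :
  scalar f -> scalar g -> scalar h ->
  tpair3 f g h (id_tens D t) = tpair f (tpair g h \o D) t.
Proof.
move=> fP gP hP; rewrite [LHS]scalar_tlift; last exact: tpair_scalar.
apply: (tlift_ext (W := k^o)) => a b; rewrite [LHS]tpair_tens //.
exact: tpair_scalar.
Qed.

Lemma tpair3_sum2 (I : Type) (S : seq I) (X Y Z : I -> I -> L)
    (f g h : L -> k) : scalar f -> scalar g -> scalar h ->
  tpair3 f g h (\sum_(i <- S) \sum_(j <- S) X i j ⊗ (Y i j ⊗ Z i j)) =
  \sum_(i <- S) \sum_(j <- S) f (X i j) * (g (Y i j) * h (Z i j)).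
Proof.
move=> fP gP hP; rewrite [LHS]scalar_sum; last exact: tpair_scalar.
apply: eq_bigr => i _; rewrite [LHS]scalar_sum; last exact: tpair_scalar.
apply: eq_bigr => j _; rewrite /tpair3 !tpair_tens //; exact: tpair_scalar.
Qed.

Lemma flip_act x t : flip (act br x t) = act br x (flip t).
Proof.
apply: tpair_inj => f g fP gP.
have [fxP gxP] := (scalar_br x fP, scalar_br x gP).
by rewrite tpair_flip // !tpair_act // !tpair_flip // addrC.
Qed.

Lemma Delta_in_Im r x : in_Im_1_sub_flip r -> in_Im_1_sub_flip (Delta br r x).
Proof.
case=> t ->; exists (act br x t); rewrite flip_act.
by rewrite /Delta /act linearB.
Qed.

Lemma br_anti x y : is_lie_bracket br -> br y x = - br x y.
Proof.
case=> alt _; apply/eqP; rewrite -addr_eq0; apply/eqP.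
have := alt (x + y); rewrite linearDl !linearDr /=.
by rewrite !alt add0r addr0 addrC.
Qed.

Lemma tpair_subl (f f1 f2 g : L -> k) t :
  (forall a, f a = f1 a - f2 a) -> tpair f g t = tpair f1 g t - tpair f2 g t.
Proof.
move=> E; rewrite /tpair /tlift -sumrB; apply: eq_bigr => i _.
rewrite -sumrB; apply: eq_bigr => j _; rewrite E mulrBl; exact: mulrBr.
Qed.

Lemma tpair_subr (f g g1 g2 : L -> k) t :
  (forall a, g a = g1 a - g2 a) -> tpair f g t = tpair f g1 t - tpair f g2 t.
Proof.
move=> E; rewrite /tpair /tlift -sumrB; apply: eq_bigr => i _.
rewrite -sumrB; apply: eq_bigr => j _; rewrite E mulrBr; exact: mulrBr.
Qed.

Lemma br_br x y z : is_lie_bracket br ->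
  br (br x y) z = br x (br y z) - br y (br x z).
Proof.
move=> hL; have [_ J] := hL; apply: scalar_inj => f fP.
have [f0 fD fN _] := scalar_morph fP; have := congr1 f (J x y z).
rewrite (br_anti x z) // linearNr (br_anti (br x y) z) // f0 !fD !fN => E.
(* The vanishing Jacobi sum is added to the left side, which turns the goal into a formal
   identity. *)
by rewrite -[LHS]addr0 -[X in _ + X = _]E; ring.
Qed.

(** This is the module axiom for [L ⊗ L]. After pairing, the mixed terms, where [x] acts on one
    factor and [y] on the other, cancel, and [br_br] handles each factor separately. *)
Lemma act_br x y t : is_lie_bracket br ->
  act br (br x y) t = act br x (act br y t) - act br y (act br x t).
Proof.
move=> hL; apply: tpair_inj => f g fP gP.
have [_ tD tN _] := scalar_morph (tpair_scalar f g).
rewrite tD tN !tpair_act //; do ?exact: scalar_br.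
rewrite (@tpair_subl _ ((f \o br x) \o br y) ((f \o br y) \o br x)).
  rewrite (@tpair_subr f _ ((g \o br x) \o br y) ((g \o br y) \o br x)).
    by ring.
  by move=> a /=; rewrite br_br //; case: (scalar_morph gP) => _ -> -> _.
by move=> a /=; rewrite br_br //; case: (scalar_morph fP) => _ -> -> _.
Qed.

(** The cocycle condition for [Delta br r] is the module axiom [act_br], and its values are
    antisymmetric because the action commutes with [flip]. Only co-Jacobi remains. *)
Lemma is_coboundaryE r : is_lie_bracket br -> in_Im_1_sub_flip r ->
  is_coboundary br r <->
  forall x, let t := id_tens (Delta br r) (Delta br r x) in
    t + cycle3 t + cycle3 (cycle3 t) = 0.
Proof.
move=> hL rI; split=> [[_ [_ [_ ]]] //|J].
split=> //; split=> [//||x y]; last exact: act_br.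
by split=> // x; apply: Delta_in_Im.
Qed.

End Coboundary.

(** * The bracket in coordinates *)

Section ThreeDim.
Variables (k : fieldType) (L : vectType k) (br : {bilinear L -> L -> L}).
Hypothesis hL : is_lie_bracket br.
Variables (e1 e2 e3 : L) (alpha beta gamma delta : k).
Hypothesis he : basis_of fullv [:: e1; e2; e3].
Hypothesis h12 : br e1 e2 = 0.
Hypothesis h13 : br e1 e3 = alpha *: e1 + beta *: e2.
Hypothesis h23 : br e2 e3 = gamma *: e1 + delta *: e2.

Let vec a b c := a *: e1 + b *: e2 + c *: e3.

Lemma scalar_vec (f : L -> k) a b c : scalar f ->
  f (vec a b c) = a * f e1 + b * f e2 + c * f e3.
Proof. by case/scalar_morph=> _ fD _ fZ; rewrite !fD !fZ. Qed.

Lemma br_vec a1 a2 a3 b1 b2 b3 :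
  br (vec a1 a2 a3) (vec b1 b2 b3) =
  vec ((a1 * b3 - a3 * b1) * alpha + (a2 * b3 - a3 * b2) * gamma)
      ((a1 * b3 - a3 * b1) * beta + (a2 * b3 - a3 * b2) * delta) 0.
Proof.
have [alt _] := hL; have h21 := br_anti e1 e2 hL; have h31 := br_anti e1 e3 hL.
have h32 := br_anti e2 e3 hL.
rewrite h12 in h21; rewrite h13 in h31; rewrite h23 in h32.
apply: scalar_inj => f fP; rewrite scalar_vec // /vec.
have [f0 fD fN fZ] := scalar_morph fP.
rewrite !(linearDl, linearDr, linearZl_LR, linearZr_LR) /=.
rewrite !(alt, h12, h13, h23, h21, h31, h32).
rewrite !(fD, fZ, fN, f0); ring.
Qed.

Lemma e1_vec : e1 = vec 1 0 0.
Proof. by rewrite /vec !scale0r scale1r !addr0. Qed.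
Lemma e2_vec : e2 = vec 0 1 0.
Proof. by rewrite /vec !scale0r scale1r add0r addr0. Qed.
Lemma e3_vec : e3 = vec 0 0 1.
Proof. by rewrite /vec !scale0r scale1r !add0r. Qed.

Lemma vec_surj x : exists a b c, x = vec a b c.
Proof.
have xE : x \in <<[:: e1; e2; e3]>>%VS by rewrite (span_basis he) memvf.
rewrite (coord_span (X := [tuple e1; e2; e3]) xE).
by rewrite !big_ord_recl big_ord0 addr0 addrA /=; do 3!eexists.
Qed.

(** * Coordinates on the antisymmetric tensors *)

Let bivec p s u : tensor L L :=
  p *: (e1 ⊗ e2) - p *: (e2 ⊗ e1) + s *: (e1 ⊗ e3) - s *: (e3 ⊗ e1)
  + u *: (e2 ⊗ e3) - u *: (e3 ⊗ e2).

Lemma tpair_bivec (f g : L -> k) p s u : scalar f -> scalar g ->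
  tpair f g (bivec p s u) =
    p * (f e1 * g e2 - f e2 * g e1) + s * (f e1 * g e3 - f e3 * g e1)
    + u * (f e2 * g e3 - f e3 * g e2).
Proof.
move=> fP gP; have [_ tD tN tZ] := scalar_morph (tpair_scalar f g).
rewrite /bivec !(tD, tN, tZ) !tpair_tens //; ring.
Qed.

Lemma bivec_in_Im p s u : in_Im_1_sub_flip (bivec p s u).
Proof.
exists (p *: (e1 ⊗ e2) + s *: (e1 ⊗ e3) + u *: (e2 ⊗ e3)).
rewrite /flip !linearD !linearZ /= -/(flip _) -/(flip _) -/(flip _).
apply: tpair_inj => f g fP gP.
have [_ tD tN tZ] := scalar_morph (tpair_scalar f g).
by rewrite tpair_bivec // !(tD, tN, tZ) !tpair_flip // !tpair_tens //; ring.
Qed.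

Lemma Im_bivec t : in_Im_1_sub_flip t -> exists p s u, t = bivec p s u.
Proof.
pose Q (t : tensor L L) := exists p s u, t = bivec p s u.
have Q0 : Q 0.
  exists 0, 0, 0; apply: tpair_inj => f g fP gP; rewrite tpair_bivec //.
  by have [-> _ _ _] := scalar_morph (tpair_scalar f g); ring.
have QD x y : Q x -> Q y -> Q (x + y).
  move=> [p [s [u ->]]] [p' [s' [u' ->]]]; exists (p + p'), (s + s'), (u + u').
  apply: tpair_inj => f g fP gP.
  have [_ tD _ _] := scalar_morph (tpair_scalar f g).
  by rewrite tD !tpair_bivec //; ring.
have QZ c x : Q x -> Q (c *: x).
  move=> [p [s [u ->]]]; exists (c * p), (c * s), (c * u).
  apply: tpair_inj => f g fP gP.
  have [_ _ _ tZ] := scalar_morph (tpair_scalar f g).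
  by rewrite tZ !tpair_bivec //; ring.
pose N (t : tensor L L) := Q (t - flip t).
have N0 : N 0 by rewrite /N /flip linear0 subr0.
have ND x y : N x -> N y -> N (x + y).
  by rewrite /N /flip linearD opprD addrACA; apply: QD.
case=> s ->; rewrite -/(Q _) -/(N s) (tensor_expand s).
(* The tensors [t] with [t - flip t] of the form [bivec] are closed under sums, so scalar multiples
   of pure tensors suffice. *)
apply: (big_ind N) => // i _; apply: (big_ind N) => // j _.
rewrite /N /flip linearZ /= -/(flip _) flip_tens -scalerBr; apply: QZ.
have [a1 [a2 [a3 ->]]] := vec_surj (vbasis {:L})`_i.
have [b1 [b2 [b3 ->]]] := vec_surj (vbasis {:L})`_j.
(* The witnesses are the 2 x 2 minors of the two coordinate vectors. *)
exists (a1 * b2 - a2 * b1), (a1 * b3 - a3 * b1), (a2 * b3 - a3 * b2).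
apply: tpair_inj => f g fP gP; rewrite tpair_bivec //.
have [_ tD tN _] := scalar_morph (tpair_scalar f g).
by rewrite tD tN !tpair_tens // !scalar_vec //; ring.
Qed.

(** * The Yang-Baxter expression *)

Let disc s u := - beta * s ^+ 2 + gamma * u ^+ 2 + (alpha - delta) * u * s.

(** The determinant of the values of [f], [g], [h] at the basis, that is the value of f (x) g (x) h
    on e1 /\ e2 /\ e3. *)
Let det3 (f g h : L -> k) :=
  f e1 * (g e2 * h e3 - g e3 * h e2) - f e2 * (g e1 * h e3 - g e3 * h e1)
  + f e3 * (g e1 * h e2 - g e2 * h e1).

(** Grouping the terms through w leaves four pure tensors: those of p e1 /\ e2 and of w /\ e3. This
    is the shape the bracket formulas require. *)
Lemma bivec_sum p s u : bivec p s u =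
  \sum_(i <- [:: (vec p 0 0, vec 0 1 0); (vec 0 (- p) 0, vec 1 0 0);
                 (vec s u 0, vec 0 0 1); (vec 0 0 (- 1), vec s u 0)])
     i.1 ⊗ i.2.
Proof.
apply: tpair_inj => f g fP gP; rewrite tpair_bivec // tpair_sum //.
by rewrite !(big_cons, big_nil) /= !scalar_vec //; ring.
Qed.

Lemma tpair3_cybe p s u (f g h : L -> k) (r := bivec p s u) :
  scalar f -> scalar g -> scalar h ->
  tpair3 f g h (bracket12_13 br r + bracket12_23 br r + bracket13_23 br r) =
  disc s u * det3 f g h.
Proof.
move=> fP gP hP.
have [_ tD _ _] := scalar_morph (tpair_scalar f (tpair g h)).
rewrite /tpair3 !tD (bracket12_13E br (bivec_sum p s u)).
rewrite (bracket12_23E br (bivec_sum p s u)).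
rewrite (bracket13_23E br (bivec_sum p s u)).
rewrite -!/(tpair3 _ _ _ _) !tpair3_sum2 // !(big_cons, big_nil) /= !br_vec.
rewrite !scalar_vec // /disc /det3; ring.
Qed.

(** * The co-Jacobi expression *)

Lemma br_vecl a b c :
  [/\ br (vec a b c) e1 = vec (- c * alpha) (- c * beta) 0,
      br (vec a b c) e2 = vec (- c * gamma) (- c * delta) 0
    & br (vec a b c) e3 = vec (a * alpha + b * gamma) (a * beta + b * delta) 0].
Proof.
split.
- by rewrite [X in br _ X]e1_vec br_vec; congr vec; ring.
- by rewrite [X in br _ X]e2_vec br_vec; congr vec; ring.
- by rewrite [X in br _ X]e3_vec br_vec; congr vec; ring.
Qed.

(** With v = a e1 + b e2, the element [vec a b c] acts on <e1,e2> as -c T and sends e3 to T v. So e1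
    /\ e2 is scaled by -c (alpha + delta), and w /\ e3 becomes -c T w /\ e3 + w /\ T v. *)
Lemma Delta_vec p s u a b c : Delta br (bivec p s u) (vec a b c) =
  bivec (- c * (alpha + delta) * p + s * (a * beta + b * delta)
           - u * (a * alpha + b * gamma))
        (- c * (alpha * s + gamma * u)) (- c * (beta * s + delta * u)).
Proof.
have [b1 b2 b3] := br_vecl a b c.
apply: tpair_inj => f g fP gP.
rewrite tpair_act // !tpair_bivec //=; do ?exact: scalar_br.
rewrite !b1 !b2 !b3 !scalar_vec //; ring.
Qed.

(** The cobracket sends e1 and e2 to multiples of e1 /\ e2, and e3 to -(alpha + delta) p e1 /\ e2 -
    T w /\ e3. The three summands collect the terms in [P], those ending in the cobracket of e3, and
    those starting with e3. *)
Lemma tpair3_id_tens_Delta p s u P S U (f g h : L -> k) (r := bivec p s u) :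
  scalar f -> scalar g -> scalar h ->
  tpair3 f g h (id_tens (Delta br r) (bivec P S U)) =
    P * (f e1 * (s * delta - u * gamma) - f e2 * (s * beta - u * alpha))
      * (g e1 * h e2 - g e2 * h e1)
  - (S * f e1 + U * f e2)
      * ((alpha + delta) * p * (g e1 * h e2 - g e2 * h e1)
         + (alpha * s + gamma * u) * (g e1 * h e3 - g e3 * h e1)
         + (beta * s + delta * u) * (g e2 * h e3 - g e3 * h e2))
  - f e3 * (S * (s * beta - u * alpha) + U * (s * delta - u * gamma))
         * (g e1 * h e2 - g e2 * h e1).
Proof.
move=> fP gP hP; rewrite tpair3_id_tens // tpair_bivec //; last first.
  by move=> l x y; rewrite /= Delta_is_linear tpair_scalar.
rewrite /= [in Delta _ _ e1]e1_vec [in Delta _ _ e2]e2_vec.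
rewrite [in Delta _ _ e3]e3_vec /r !Delta_vec !tpair_bivec //; ring.
Qed.

(** The right side is the action of [vec a b c] on the Yang-Baxter expression: the factor -c (alpha
    + delta) is the trace of its adjoint map. *)
Lemma tpair3_cojacobi p s u a b c (f g h : L -> k) :
  scalar f -> scalar g -> scalar h ->
  let D := Delta br (bivec p s u) in let t := id_tens D (D (vec a b c)) in
  tpair3 f g h (t + cycle3 t + cycle3 (cycle3 t)) =
  - (alpha + delta) * c * disc s u * det3 f g h.
Proof.
move=> fP gP hP D t.
have [_ tD _ _] := scalar_morph (tpair_scalar f (tpair g h)).
rewrite /tpair3 !tD -!/(tpair3 _ _ _ _) !tpair3_cycle // /t /D Delta_vec.
rewrite !tpair3_id_tens_Delta // /disc /det3; ring.
Qed.

(** * Scalar criteria for the two structures *)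

Lemma tpair3_det3_eq0P (t : tensor L (tensor L L)) c :
  (forall f g h : L -> k, scalar f -> scalar g -> scalar h ->
     tpair3 f g h t = c * det3 f g h) -> t = 0 <-> c = 0.
Proof.
move=> E; have t0 f g h : tpair3 f g h (0 : tensor L (tensor L L)) = 0.
  by have [] := scalar_morph (tpair_scalar f (tpair g h)).
split=> [tE|c0]; last first.
  by apply: tpair3_inj => f g h fP gP hP; rewrite t0 E // c0 mul0r.
(* On the dual basis [det3] equals 1, which recovers [c]. *)
have fr := basis_free he; pose X := [tuple e1; e2; e3].
have cE (i j : 'I_3) : coord X i X`_j = (j == i)%:R by apply: coord_free.
have c1 i : coord X i e1 = (0 == i)%:R := cE i 0.
have c2 i : coord X i e2 = (1 == i)%:R := cE i 1.
have c3 i : coord X i e3 = (2 == i)%:R := cE i 2.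
have := E (coord X 0) (coord X 1) (coord X 2); rewrite tE t0 /det3.
rewrite !c1 !c2 !c3 /= => ->; do ?exact: linearP.
by rewrite !(mulr0, mul0r, mulr1, subr0, addr0, subrr).
Qed.

Lemma bivec_cybeP p s u : is_cybe_solution br (bivec p s u) <-> disc s u = 0.
Proof. by apply: tpair3_det3_eq0P => f g h; apply: tpair3_cybe. Qed.

Lemma bivec_coboundaryP p s u :
  is_coboundary br (bivec p s u) <-> (alpha + delta) * disc s u = 0.
Proof.
have J a b c := tpair3_det3_eq0P (tpair3_cojacobi p s u a b c).
apply: (iff_trans (is_coboundaryE hL (bivec_in_Im p s u))); split=> [E|E x].
  (* The element e3, where c = 1, detects the whole condition. *)
  have /(J 0 0 1) := E (vec 0 0 1).
  by rewrite mulr1 mulNr => /eqP; rewrite oppr_eq0 => /eqP.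
have [a [b [c ->]]] := vec_surj x; apply/J.
by rewrite !mulNr mulrAC E mul0r oppr0.
Qed.

Lemma bivec_triangularP p s u :
  is_triangular br (bivec p s u) <-> disc s u = 0.
Proof.
split=> [[_ /bivec_cybeP]//|d0]; split; last exact/bivec_cybeP.
by apply/bivec_coboundaryP; rewrite d0 mulr0.
Qed.

End ThreeDim.

(** * Diagonalizable matrices with a single characteristic root, and the theorem *)

Lemma diagonalizable_equal_roots (F : fieldType) n (A : 'M[F]_n) (x : F) m :
  diagonalizable A -> char_poly A = ('X - x%:P) ^+ m -> A = x%:M.
Proof.
case=> Q Qu /diagonalizable_forPex[d /(simmxP Qu) QA] chA.
(* Conjugation fixes scalar matrices, so it suffices that the diagonal form is scalar. *)
suff dE : diag_mx d = x%:M.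
  by rewrite -[A](mulKmx Qu) QA dE -scalar_mxC mulKmx.
apply/matrixP => i j; rewrite !mxE; case: eqP => [->|//]; rewrite !mulr1n.
(* [row j Q] is a left eigenvector, nonzero since [Q] is invertible; hence [d 0 j] is a root of the
   characteristic polynomial and equals [x]. *)
have : eigenvalue A (d 0 j).
  apply/eigenvalueP; exists (row j Q).
    by rewrite -row_mul QA mul_diag_mx; apply/rowP => l; rewrite !mxE.
  apply/eqP => Q0; have := congr1 (row j) (mulmxV Qu).
  rewrite row_mul Q0 mul0mx => /rowP/(_ j)/eqP.
  by rewrite !mxE eqxx eq_sym oner_eq0.
rewrite eigenvalue_root_char chA rootE horner_exp !hornerE expf_eq0 subr_eq0.
by case/andP=> _ /eqP.
Qed.

Theorem theorem4p1 (k : fieldType) (P : closedFieldType)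
    (iota : {rmorphism k -> P}) (hP : is_algebraic_closure iota)
    (L : vectType k) (br : {bilinear L -> L -> L}) (hL : is_lie_bracket br)
    (e1 e2 e3 : L) (he : basis_of fullv [:: e1; e2; e3])
    (alpha beta gamma delta : k)
    (h12 : br e1 e2 = 0)
    (h13 : br e1 e3 = alpha *: e1 + beta *: e2)
    (h23 : br e2 e3 = gamma *: e1 + delta *: e2)
    (hdet : alpha * delta - beta * gamma != 0)
    (A : 'M[k]_2) (hA : A = mx2 alpha gamma beta delta)
    (p u s : k) (r : tensor L L)
    (hr : r = p *: (e1 ⊗ e2) - p *: (e2 ⊗ e1)
            + s *: (e1 ⊗ e3) - s *: (e3 ⊗ e1)
            + u *: (e2 ⊗ e3) - u *: (e3 ⊗ e2)) :
  [/\ is_coboundary br r <->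
        row2 s u *m mx2 (beta * delta + alpha * beta)
                        (- beta * gamma - alpha ^+ 2)
                        (delta ^+ 2 + gamma * beta)
                        (- delta * gamma - gamma * alpha)
          *m (row2 s u)^T = 0,
      char2_equal_roots_diag iota A ->
        forall r' : tensor L L, in_Im_1_sub_flip r' -> is_triangular br r'
    & ~ char2_equal_roots_diag iota A ->
        (is_triangular br r <->
           - beta * s ^+ 2 + gamma * u ^+ 2 + (alpha - delta) * u * s = 0)].
Proof.
have triP p' s' u' := bivec_triangularP hL he h12 h13 h23 p' s' u'.
split; last by move=> _; rewrite hr; apply: triP.
  rewrite hr; apply: (iff_trans (bivec_coboundaryP hL he h12 h13 h23 p s u)).
  set M := _ *m _ *m _.
  (* The quadratic form in (I) factors as minus the trace of [A] times the form in (III). *)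
  have ME : M 0 0 = - ((alpha + delta) *
      (- beta * s ^+ 2 + gamma * u ^+ 2 + (alpha - delta) * u * s)).
    do 2![rewrite !mxE !big_ord_recl !big_ord0]; rewrite !mxE /=; ring.
  split=> [d0|M0]; first by apply/matrixP => i j; rewrite !ord1 ME d0 oppr0 mxE.
  by apply/eqP; rewrite -oppr_eq0 -ME M0 mxE.
case=> _ [x [y [chA xy]]] dA r' r'I; rewrite -xy -expr2 in chA.
have /matrixP AE := diagonalizable_equal_roots dA chA.
(* [A] is scalar over [P]; injectivity of [iota] carries this back to [k] entry by entry. *)
have inj0 (z w : k) : iota z = iota w -> z = w by apply: fmorph_inj.
have g0 : gamma = 0.
  by apply: inj0; have := AE 0 1; rewrite hA !mxE /= rmorph0.
have b0 : beta = 0.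
  by apply: inj0; have := AE 1 0; rewrite hA !mxE /= rmorph0.
have ad : alpha = delta.
  by apply: inj0; have := AE 0 0; have := AE 1 1; rewrite hA !mxE /= => -> ->.
have [p' [s' [u' ->]]] := Im_bivec he r'I; apply/triP.
by rewrite g0 b0 ad subrr oppr0 !mul0r !addr0.
Qed.
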